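(* Let $\Omega\subset\mathbb{R}^N$ ($N\geq1$) be an open and bounded $BV$ extension domain, and let $u\in\mathcal{R}_\infty(\Omega)$ and $\varepsilon>0$. Then there is a function $v\in BV(\Omega)$ with $\|u-v\|_\infty\le\varepsilon$ and $\mathrm{Var}\,v=(\varepsilon,\infty)\text{-}\mathrm{Var}\,u$.
   Context: Functions are real-valued and elements of $L^1(\Omega)$ are identified when they agree Lebesgue-almost everywhere; $\|\cdot\|_1$ and $\|\cdot\|_\infty$ are the $L^1(\Omega)$- and $L^\infty(\Omega)$-norms. When $N=1$, $\Omega$ is assumed to be an interval. Variation: for $u\in L^1(\Omega)$, $\mathrm{Var}\,u:=\sup\{\int_\Omega u\,\mathrm{div}\,\varphi\,dx \mid \varphi\in[C_c^1(\Omega)]^N,\ \|\varphi\|_\infty\le 1\}\in[0,\infty]$, and $BV(\Omega):=\{u\in L^1(\Omega)\mid \mathrm{Var}\,u<\infty\}$, a Banach space with norm $\|u\|_{BV}=\|u\|_1+\mathrm{Var}\,u$. $BV$ extension domain (Ambrosio–Fusco–Pallara, Definition 3.20): an open set $\Omega\subset\mathbb{R}^N$ with bounded boundary such that for every open set $A\supset\overline{\Omega}$ and every $m\ge1$ there is a linear continuous extension operator $T:[BV(\Omega)]^m\to[BV(\mathbb{R}^N)]^m$ (so $Tu=u$ a.e. in $\Omega$) with: $Tu=0$ a.e. in $\mathbb{R}^N\setminus A$ for all $u\in[BV(\Omega)]^m$; $|D(Tu)|(\partial\Omega)=0$ for all $u\in[BV(\Omega)]^m$; and for every $q\in[1,\infty]$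 the restriction of $T$ to $[W^{1,q}(\Omega)]^m$ is a linear continuous map into $[W^{1,q}(\mathbb{R}^N)]^m$. $(\varepsilon,\infty)$-variation: for $u\in L^1(\Omega)$ and $\varepsilon>0$, $(\varepsilon,\infty)\text{-}\mathrm{Var}\,u:=\inf\{\mathrm{Var}\,v\mid v\in BV(\Omega),\ \|u-v\|_\infty\le\varepsilon\}$, with the convention that the infimum over the empty set is $\infty$. $\infty$-regulated functions: $\mathcal{R}_\infty(\Omega):=\{u\in L^1(\Omega)\mid (\varepsilon,\infty)\text{-}\mathrm{Var}\,u<\infty\text{ for every }\varepsilon>0\}$. *)

(* Defs.v *)
From HB Require Import structures.
From mathcomp Require Import all_boot all_order all_algebra.
From mathcomp Require Import all_classical all_reals all_analysis.

Set Implicit Arguments.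
Unset Strict Implicit.
Unset Printing Implicit Defensive.

Import Order.TTheory GRing.Theory Num.Theory.
Import numFieldNormedType.Exports.

Local Open Scope classical_set_scope.
Local Open Scope ring_scope.

(* Borel sigma-algebra of R^n. *)
HB.instance Definition _ (R : realType) (n : nat) :=
  @isMeasurable.Build (sigma_display (@open 'rV[R]_n)) 'rV[R]_n
    <<s @open 'rV[R]_n >> (@sigma_algebra0 _ setT _) (@sigma_algebraC _ _)
    (@sigma_algebra_bigcup _ setT _).

Section row_cons.
Context {R : realType} (n : nat).

Definition row_cons (p : R * 'rV[R]_n) : 'rV[R]_n.+1 := row_mx p.1%:M p.2.

Lemma row_cons0 p : row_cons p 0 0 = p.1.
Proof.
have -> : (0 : 'I_n.+1) = lshift n (0 : 'I_1) by apply/val_inj.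
by rewrite /row_cons (row_mxEl p.1%:M p.2) mxE eqxx mulr1n.
Qed.

Lemma row_consS p (i : 'I_n) : row_cons p 0 (lift 0 i) = p.2 0 i.
Proof.
have -> : lift 0 i = rshift 1 i by apply/val_inj.
by rewrite /row_cons (row_mxEr p.1%:M p.2).
Qed.

End row_cons.

Lemma measurable_coord (R : realType) n (i : 'I_n) :
  measurable_fun [set: 'rV[R]_n] (fun x => x 0 i).
Proof.
apply: (measurability _ (measurable_realfun.RGenOpens.measurableE R)).
move=> _ [_ [a [b ->]] <-]; rewrite setTI; apply: sub_sigma_algebra.
apply: open_comp; last exact: interval_open.
by move=> x _; exact: coord_continuous.
Qed.

Lemma measurable_rV d (T : measurableType d) (R : realType) n
    (f : T -> 'rV[R]_n) :
  (forall i, measurable_fun [set: T] (fun t => f t 0 i)) ->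
  measurable_fun [set: T] f.
Proof.
move=> mf; apply: (@measurability _ _ _ _ _ _ (@open 'rV[R]_n)) => //.
move=> _ [U oU <-]; rewrite setTI.
pose box (q : 'rV[rat]_n * 'rV[rat]_n) : set 'rV[R]_n :=
  [set x | forall i, ratr (q.1 0 i) < x 0 i < ratr (q.2 0 i)].
have -> : f @^-1` U = \bigcup_(q in [set q | box q `<=` U]) (f @^-1` box q).
  apply/seteqP; split; last by move=> t [q /= bU] /= /bU.
  move=> t /= Uft.
  have /nbhs_ballP[e /= e0 eU] : nbhs (f t) U by exact: open_nbhs_nbhs.
  have lo i : {q : rat | f t 0 i - e < ratr q < f t 0 i}.
    apply: cid; have [q] := @rat_in_itvoo R (f t 0 i - e) (f t 0 i) ltac:(by rewrite ltrBlDr ltrDl).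
    by rewrite in_itv; exists q.
  have hi i : {q : rat | f t 0 i < ratr q < f t 0 i + e}.
    apply: cid; have [q] := @rat_in_itvoo R (f t 0 i) (f t 0 i + e) ltac:(by rewrite ltrDl).
    by rewrite in_itv; exists q.
  exists (\row_i projT1 (lo i), \row_i projT1 (hi i)) => /=.
    move=> x /= bx; apply: eU; split => // j i; rewrite (ord1 j).
    have := bx i; rewrite !mxE; case: (lo i) (hi i) => a /= /andP[a1 a2] [b /= /andP[b1 b2]] /andP[x1 x2].
    by rewrite /ball /= ltr_distlC; apply/andP; split; [exact: lt_trans x1|exact: lt_trans b2].
  move=> i; rewrite !mxE; case: (lo i) (hi i) => a /= /andP[a1 a2] [b /= /andP[b1 b2]].
  by rewrite a2.
rewrite bigcup_mkcond; apply: countable_bigcupT_measurable => // q.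
case: ifPn => // _.
have -> : f @^-1` box q =
    \bigcap_(i in [set: 'I_n]) ((fun t => f t 0 i) @^-1` `]ratr (q.1 0 i), ratr (q.2 0 i)[).
  by apply/seteqP; split => t /= tq i; [move=> _|]; have := tq i; rewrite /= in_itv//=; exact.
apply: fin_bigcap_measurable => // i _.
by rewrite -[X in measurable X]setTI; exact: mf.
Qed.

Lemma measurable_row_cons (R : realType) n :
  measurable_fun [set: R * 'rV[R]_n] (@row_cons R n).
Proof.
apply: measurable_rV => i; case: (unliftP 0 i) => [j|] ->.
- under eq_fun do rewrite row_consS.
  exact: (measurableT_comp (measurable_coord j) measurable_snd).
- by under eq_fun do rewrite row_cons0; exact: measurable_fst.
Qed.

Section lebesgue_rVS.
Context {R : realType} (n : nat) (m : {sigma_finite_measure set 'rV[R]_n -> \bar R}).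

Definition lebesgue_rVS : set 'rV[R]_n.+1 -> \bar R :=
  pushforward (@lebesgue_measure R \x m)%E (@row_cons R n).

Let lebesgue_rVS_measure : {measure set 'rV[R]_n.+1 -> \bar R} :=
  measure_function_pushforward__canonical__measure_function_Measure
    (lebesgue_measure \x m)%E (@measurable_row_cons R n).

HB.instance Definition _ := Measure.copy lebesgue_rVS lebesgue_rVS_measure.

Let lebesgue_rVS_sigma_finite : sigma_finite setT lebesgue_rVS.
Proof.
have /sigma_finiteP[F [TF ndF mF]] := sigma_finiteT (@lebesgue_measure R).
have /sigma_finiteP[G [TG ndG mG]] := sigma_finiteT m.
pose H k : set 'rV[R]_n.+1 :=
  [set x | F k (x 0 0) /\ G k (\row_i x 0 (lift 0 i))].
have HE k : @row_cons R n @^-1` H k = F k `*` G k.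
  apply/seteqP; split=> p; rewrite /H /= row_cons0;
    suff -> : \row_i row_cons p 0 (lift 0 i) = p.2 by [].
  - by apply/rowP => i; rewrite mxE row_consS.
  - by apply/rowP => i; rewrite mxE row_consS.
exists H.
  apply/seteqP; split=> // x _.
  have [a _ Fa] : (\bigcup_i F i) (x 0 0) by rewrite -TF.
  have [b _ Gb] : (\bigcup_i G i) (\row_i x 0 (lift 0 i)) by rewrite -TG.
  exists (maxn a b) => //; split.
    by move: Fa; exact/subsetPset/ndF/leq_maxl.
  by move: Gb; exact/subsetPset/ndG/leq_maxr.
move=> k; have [? ?] := mF k; have [? ?] := mG k; split.
  apply: measurableI; rewrite -[X in measurable X]setTI.
    exact: measurable_coord.
  apply: measurable_rV => // i; under eq_fun do rewrite mxE.
  exact: measurable_coord.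
rewrite /lebesgue_rVS /pushforward HE.
by rewrite product_measure1E// lte_mul_pinfty// ge0_fin_numE.
Qed.

HB.instance Definition _ := Measure_isSigmaFinite.Build _ _ _ lebesgue_rVS
  lebesgue_rVS_sigma_finite.

End lebesgue_rVS.

(* The iterated product measure, transported along R * R^n ~ R^(n+1); it is
   characterized by lebesgue_rV_box. *)
Fixpoint lebesgue_rV (R : realType) (n : nat) :
    {sigma_finite_measure set 'rV[R]_n -> \bar R} :=
  match n with
  | 0 => @dirac _ 'rV[R]_0 0 R
  | k.+1 => lebesgue_rVS (lebesgue_rV R k)
  end.

Lemma lebesgue_rV_box (R : realType) n (A : 'I_n -> set R) :
  (forall i, measurable (A i)) ->
  lebesgue_rV R n [set x | forall i, A i (x 0 i)] =
  (\prod_(i < n) lebesgue_measure (A i))%E.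
Proof.
elim: n A => [|n IHn] A mA /=.
  by rewrite big_ord0 diracE mem_set//= => -[].
have mAS : measurable [set x : 'rV[R]_n | forall i, A (lift 0 i) (x 0 i)].
  rewrite [X in measurable X](_ : _ = \bigcap_(i in [set: 'I_n])
      ((fun x : 'rV[R]_n => x 0 i) @^-1` A (lift 0 i))); last first.
    by apply/seteqP; split=> x /= Ax i; [move=> _|]; exact: Ax.
  apply: fin_bigcap_measurable => // i _; rewrite -[X in measurable X]setTI.
  exact: measurable_coord.
rewrite big_ord_recl -IHn// /lebesgue_rVS /pushforward.
transitivity ((@lebesgue_measure R \x lebesgue_rV R n)%E
  (A 0 `*` [set x : 'rV[R]_n | forall i : 'I_n, A (lift 0 i) (x 0 i)])).
  congr (_ _); apply/seteqP; split=> p /=.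
    by move=> Ap; split=> [|i]; [rewrite -row_cons0|rewrite -row_consS].
  move=> [A0 AS] i; case: (unliftP 0 i) => [j|] ->; first by rewrite row_consS.
  by rewrite row_cons0.
exact: (@product_measure1E _ _ _ _ R lebesgue_measure (lebesgue_rV R n) _ _
  (mA 0) mAS).
Qed.

(* Elements of function spaces on D are represented by functions on all of R^N
   whose values outside D are irrelevant; equality in L^1(D) is equality almost
   everywhere in D. *)
Section variation.
Context {R : realType} {N : nat}.
Implicit Types (D : set 'rV[R]_N) (u v g : 'rV[R]_N -> R) (q : \bar R).

Local Notation mu := (lebesgue_rV R N).

(* The norm `|x| of 'rV[R]_n is the sup norm, which defines the topology; the
   pointwise bound on vector fields uses the Euclidean norm. *)
Definition enorm n (x : 'rV[R]_n) : R := Num.sqrt (\sum_(i < n) (x 0 i) ^+ 2).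

(* Extending by 0 does not change the L^q norm for q >= 1, including the
   essential supremum of |u| when q = +oo. *)
Definition Lnorm_on q D u : \bar R := Lnorm mu q ((EFin \o u) \_ D).

Definition L1 D : set ('rV[R]_N -> R) :=
  [set u | mu.-integrable D (EFin \o u)].

Definition Lq q D : set ('rV[R]_N -> R) :=
  [set u | measurable_fun D u /\ (Lnorm_on q D u < +oo)%E].

(* Elements of C_c^1(D; W), extended by 0 to R^N. *)
Definition C1c (W : normedModType R) D : set ('rV[R]_N -> W) :=
  [set phi | [/\ forall x, differentiable phi x,
                 forall h, continuous (fun x => 'D_h phi x),
                 compact (closure [set x | phi x != 0]) &
                 closure [set x | phi x != 0] `<=` D]].

Definition unit_row (j : 'I_N) : 'rV[R]_N := delta_mx 0 j.

Definition divergence (phi : 'rV[R]_N -> 'rV[R]_N) (x : 'rV[R]_N) : R :=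
  \sum_(i < N) ('D_(unit_row i) phi x) 0 i.

Definition Var D u : \bar R :=
  ereal_sup [set (\int[mu]_(x in D) (u x * divergence phi x)%:E)%E | phi in
    [set phi : 'rV[R]_N -> 'rV[R]_N |
      C1c D phi /\ (Lnorm_on +oo D (fun x => enorm (phi x)) <= 1)%E]].

Definition BV D : set ('rV[R]_N -> R) :=
  [set u | L1 D u /\ (Var D u < +oo)%E].

Definition epsVar (eps : R) D u : \bar R :=
  ereal_inf [set Var D v | v in
    [set v | BV D v /\ (Lnorm_on +oo D (u \- v)%R <= eps%:E)%E]].

Definition Rinfty D : set ('rV[R]_N -> R) :=
  [set u | L1 D u /\ forall eps : R, 0 < eps -> (epsVar eps D u < +oo)%E].

Definition is_weak_partial D (j : 'I_N) u g : Prop :=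
  forall phi : 'rV[R]_N -> R, C1c D phi ->
    (\int[mu]_(x in D) (u x * 'D_(unit_row j) phi x)%:E =
     - \int[mu]_(x in D) (g x * phi x)%:E)%E.

Definition W1q q D : set ('rV[R]_N -> R) :=
  [set u | Lq q D u /\
    forall j, exists g, Lq q D g /\ is_weak_partial D j u g].

(* The weak derivative is unique up to a null set of D; xget selects a
   representative. *)
Definition weak_partial q D (j : 'I_N) u : 'rV[R]_N -> R :=
  xget (cst 0) [set g | Lq q D g /\ is_weak_partial D j u g].

Section vector_valued.
Context {m : nat}.
Implicit Types (w : 'I_m -> 'rV[R]_N -> R).

Definition BV_norm D w : \bar R :=
  (\sum_(i < m) (Lnorm_on 1 D (w i) + Var D (w i)))%E.

Definition W1q_norm q D w : \bar R :=
  (\sum_(i < m) (Lnorm_on q D (w i) +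
    \sum_(j < N) Lnorm_on q D (weak_partial q D j (w i))))%E.

(* Dw is the matrix-valued measure representing the distributional gradient of
   w on R^N. The integral against a signed measure is taken through its Jordan
   decomposition, which does not depend on the Hahn decomposition (P, M). *)
Definition is_derivative_measure w
    (Dw : 'I_m -> 'I_N -> {charge set 'rV[R]_N -> \bar R}) : Prop :=
  forall i j (phi : 'rV[R]_N -> R), C1c setT phi ->
  forall P M (PM : hahn_decomposition (Dw i j) P M),
    (\int[mu]_x (w i x * 'D_(unit_row j) phi x)%:E =
     - (\int[jordan_pos PM]_x (phi x)%:E - \int[jordan_neg PM]_x (phi x)%:E))%E.

(* |Dw|(B), the supremum over countable Borel partitions E of B of the sums of
   the Euclidean (Frobenius) norms of Dw (E k). *)
Definition variation_measure
    (Dw : 'I_m -> 'I_N -> {charge set 'rV[R]_N -> \bar R})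
    (B : set 'rV[R]_N) : \bar R :=
  ereal_sup [set (\sum_(0 <= k <oo)
      (Num.sqrt (\sum_(i < m) \sum_(j < N) (fine (Dw i j (E k))) ^+ 2))%:E)%E
    | E in [set E : (set 'rV[R]_N)^nat |
        [/\ forall k, measurable (E k), trivIset setT E & \bigcup_k E k = B]]].

Definition continuous_on_wrt (X : set ('I_m -> 'rV[R]_N -> R))
    (nX nY : ('I_m -> 'rV[R]_N -> R) -> \bar R)
    (T : ('I_m -> 'rV[R]_N -> R) -> ('I_m -> 'rV[R]_N -> R)) : Prop :=
  forall w, X w -> forall e : R, 0 < e -> exists2 d : R, 0 < d &
    forall w', X w' -> (nX (w' - w)%R < d%:E)%E -> (nY (T w' - T w)%R < e%:E)%E.

End vector_valued.

Definition boundary D : set 'rV[R]_N := closure D `\` D°.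

(* T acts on representatives. Continuity makes it well defined on classes:
   if w' - w has norm 0 on Omega then T w' - T w has norm 0.
   Sobolev functions are intersected with BV(Omega), the domain of T; this is
   automatic when Omega is bounded. *)
Definition is_BV_extension_operator (Omega A : set 'rV[R]_N) (m : nat)
    (T : ('I_m -> 'rV[R]_N -> R) -> ('I_m -> 'rV[R]_N -> R)) : Prop :=
  let BVm D := [set w : 'I_m -> 'rV[R]_N -> R | forall i, BV D (w i)] in
  let W1qm q D := [set w : 'I_m -> 'rV[R]_N -> R | forall i, W1q q D (w i)] in
  [/\ [/\ forall w, BVm Omega w -> BVm setT (T w),
          forall (a : R) w w', BVm Omega w -> BVm Omega w' ->
            forall i, {ae mu, forall x,
              T (a *: w + w') i x = a * T w i x + T w' i x} &
          continuous_on_wrt (BVm Omega) (BV_norm Omega) (BV_norm setT) T],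
      forall w, BVm Omega w ->
        forall i, {ae mu, forall x, Omega x -> T w i x = w i x},
      forall w, BVm Omega w ->
        forall i, {ae mu, forall x, ~ A x -> T w i x = 0},
      forall w, BVm Omega w -> exists Dw,
        is_derivative_measure (T w) Dw /\
        variation_measure Dw (boundary Omega) = 0%E &
      forall q : \bar R, (1 <= q)%E ->
        (forall w, (BVm Omega `&` W1qm q Omega) w -> W1qm q setT (T w)) /\
        continuous_on_wrt (BVm Omega `&` W1qm q Omega)
          (W1q_norm q Omega) (W1q_norm q setT) T].

Definition BV_extension_domain (Omega : set 'rV[R]_N) : Prop :=
  [/\ open Omega, bounded_set (boundary Omega) &
    forall A, open A -> closure Omega `<=` A ->
    forall m, (0 < m)%N -> exists T, @is_BV_extension_operator Omega A m T].

End variation.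

(* Main.v *)
(* The functions w = u - v with |w| <= eps a.e. and Var (u - w) <= I + 1/(n+1),
   where I is the (eps, oo)-variation of u, form a decreasing sequence of convex
   sets, bounded in L^2 because Omega has finite measure. Choosing w_n in these
   sets with nearly minimal L^2 norm, the parallelogram identity makes (w_n)
   Cauchy in L^2, fast enough to converge almost everywhere. As |w_n| <= eps,
   dominated convergence passes to the limit in each integral defining Var, so
   the limit w satisfies Var (u - w) <= I. *)
Require Import Defs.
From mathcomp Require Import all_boot all_order all_algebra.
From mathcomp Require Import all_classical all_reals all_analysis.
From mathcomp Require Import measurable_realfun ess_sup_inf lra.

Set Implicit Arguments.
Unset Strict Implicit.
Unset Printing Implicit Defensive.

Import Order.TTheory GRing.Theory Num.Theory.
Import numFieldNormedType.Exports.

Local Open Scope classical_set_scope.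
Local Open Scope ring_scope.

(** * Almost everywhere convergence from L^2 estimates on a measure space *)

(** Taking square roots bounds [|a n|] by [Num.sqrt C / 2 ^+ n], so a geometric series dominates. *)
Lemma cvg_series_of_geometric_sqr (R : realType) (a : R^nat) (C : R) :
  (forall n, 4 ^+ n * (a n) ^+ 2 <= C) -> cvgn (series a).
Proof.
move=> aC; apply: normed_cvg.
apply: (@series_le_cvg _ _ (geometric (Num.sqrt C) 2^-1)) => [n|n|n|].
- exact: normr_ge0.
- by rewrite /= mulr_ge0 ?sqrtr_ge0// exprn_ge0// invr_ge0.
- rewrite /= -sqrtr_sqr exprVn ler_pdivlMr ?exprn_gt0//.
  rewrite -[X in _ * X]ger0_norm ?exprn_ge0// -sqrtr_sqr -sqrtrM ?sqr_ge0//.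
  rewrite ler_wsqrtr// mulrC -exprM mulnC exprM (_ : 2 ^+ 2 = 4)//; last by rewrite expr2; lra.
- by apply: is_cvg_geometric_series; rewrite ger0_norm ?invr_ge0// invf_lt1// ltr1n.
Qed.

Section measure.
Context d (T : measurableType d) (R : realType).
Variables (mu : {measure set T -> \bar R}) (D : set T).
Hypothesis mD : measurable D.

(** The weights 4^n against the bounds 8^-n leave 2^-n, so the weighted sum of the squared
    increments is integrable, hence finite almost everywhere. Where it is finite, the increments are
    summable and the telescoping series converges. *)
Lemma ae_cvg_of_geometric_L2 (f : (T -> R)^nat) :
  (forall n, measurable_fun D (f n)) ->
  (forall n, (\int[mu]_(x in D) ((f n.+1 x - f n x) ^+ 2)%:E <=
    (8 ^- n)%:E)%E) ->
  {ae mu, forall x, D x -> cvgn (f ^~ x)}.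
Proof.
move=> mf f8.
pose g n x : \bar R := (4 ^+ n * (f n.+1 x - f n x) ^+ 2)%:E.
have mg n : measurable_fun D (g n).
  apply/measurable_EFinP; apply: measurable_funM => //.
  by apply: measurable_funX; apply: measurable_funB.
have g0 n x : (0 <= g n x)%E.
  by rewrite lee_fin mulr_ge0 ?sqr_ge0// exprn_ge0.
have intg : mu.-integrable D (fun x => \sum_(0 <= n <oo) g n x)%E.
  apply/integrableP; split.
    by apply: ge0_emeasurable_sum.
  under eq_integral do rewrite gee0_abs ?nneseries_ge0//.
  rewrite integral_nneseries//.
  (* The summand is 2^-n, written in the form that [epsilon_trick0] sums to at most 2. *)
  apply: (@le_lt_trans _ _ (\sum_(0 <= n <oo) (2 / (2 ^ n.+1)%:R)%:E)%E).
    apply: lee_nneseries => [n _ _|n _]; first exact: integral_ge0.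
    under eq_integral do rewrite /g EFinM.
    rewrite ge0_integralZl_EFin//; last first.
    - apply/measurable_EFinP.
      by apply: measurable_funX; apply: measurable_funB.
    - by move=> x _; rewrite lee_fin sqr_ge0.
    apply: (@le_trans _ _ ((4 ^+ n)%:E * (8 ^- n)%:E)%E).
      by rewrite lee_wpmul2l// lee_fin exprn_ge0.
    rewrite -EFinM lee_fin natrX exprS invfM mulrA divff// mul1r -!exprVn -exprMn.
    by rewrite (_ : 4 * 8^-1 = 2^-1)//; lra.
  by apply: le_lt_trans (epsilon_trick0 _ _) (ltry _).
have := integrable_ae mD intg.
apply: filterS => x /[apply] gfin.
have -> : f ^~ x = (fun n => f 0 x + series (fun k => f k.+1 x - f k x) n).
  by apply/funext => n; rewrite seriesEnat/= telescope_sumr// addrC subrK.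
apply: is_cvgD; first exact: is_cvg_cst.
apply: (@cvg_series_of_geometric_sqr _ _ (fine (\sum_(0 <= n <oo) g n x)%E)) => n.
rewrite -lee_fin fineK// -/(g n x).
(* The partial sum of length [n.+1] is the first to contain [g n x], as its last term. *)
apply: le_trans (nneseries_lim_ge n.+1 _) => //=.
by rewrite big_nat_recr//= leeDr// sume_ge0.
Qed.

(** This is the Hilbert space argument for elements of nearly minimal norm in decreasing convex
    sets; closure under midpoints is the form of convexity that the parallelogram identity uses. *)
Lemma ae_cvg_convex_seq (K : nat -> set (T -> R)) (M : R) :
  (forall m n, (m <= n)%N -> K n `<=` K m) ->
  (forall n, K n !=set0) ->
  (forall n f g, K n f -> K n g -> K n (fun x => 2^-1 * (f x + g x))) ->
  (forall f, K 0 f -> measurable_fun D f) ->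
  (forall f, K 0 f -> mu.-integrable D (EFin \o (fun x => f x ^+ 2))) ->
  (forall f, K 0 f -> (\int[mu]_(x in D) f x ^+ 2 <= M)%R) ->
  exists w : (T -> R)^nat, (forall n, K n (w n)) /\
    {ae mu, forall x, D x -> cvgn (w ^~ x)}.
Proof.
move=> Kd K0 Kconv Kmeas Kint KM.
(* [inf S] is the limit of the nondecreasing infima of the squared L^2 norm over the sets [K n]. *)
pose S := [set r : R | forall n, exists2 f, K n f &
  (\int[mu]_(x in D) f x ^+ 2 <= r)%R].
have K_0 n f : K n f -> K 0 f by exact: Kd.
have S_inf : has_inf S.
  split.
    by exists M => n; have [f Kf] := K0 n; exists f => //; apply: KM; apply: K_0 Kf.
  exists 0 => r /(_ 0)[f _]; apply: le_trans.
  by apply: Rintegral_ge0 => x _; exact: sqr_ge0.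
(* The parallelogram estimate below costs at most [6 * e n + 2 * e n.+1], hence at most [8 * e n],
   which is [8 ^- n]. *)
pose e n : R := 8 ^- n.+1.
have e_gt0 n : 0 < e n by rewrite invr_gt0 exprn_gt0.
(* If every [K m] violated this bound, [inf S - e n] would itself belong to [S], below its
   infimum. *)
have inf_lb n : {m : nat | forall f, K m f ->
    (inf S - e n < \int[mu]_(x in D) f x ^+ 2)%R}.
  apply: cid; apply: contrapT => /forallNP H.
  have : S (inf S - e n).
    move=> m; have /existsNP[f /not_implyP[Kf /negP]] := H m.
    by rewrite -leNgt => ?; exists f.
  move=> /(ge_inf S_inf.2).
  by rewrite lerBrDr gerDl leNgt e_gt0.
pose m n := sval (inf_lb n).
(* This index is monotone, at least [n] so that [w n] lies in [K n], and at least [m n] so that the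
   lower bound [inf_lb] holds on [K (N n)]. *)
pose N n := (n + \sum_(i < n.+1) m i)%N.
have N_le n : (N n <= N n.+1)%N.
  by rewrite /N [in X in (_ <= X)%N]big_ord_recr/= leq_add// leq_addr.
have m_le n : (m n <= N n)%N.
  by rewrite /N big_ord_recr/= addnA leq_addl.
have wP n : {f | K (N n) f & (\int[mu]_(x in D) f x ^+ 2 <= inf S + e n)%R}.
  apply: cid2; have [r Sr rS] := inf_adherent (e_gt0 n) S_inf.
  have [f Kf fr] := Sr (N n); exists f => //.
  by apply: le_trans fr (ltW rS).
pose w n := s2val (wP n).
have wK n : K (N n) (w n) by exact: (s2valP (wP n)).
have wle n : (\int[mu]_(x in D) w n x ^+ 2 <= inf S + e n)%R by exact: (s2valP' (wP n)).
exists w; split.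
  by move=> n; apply: Kd (wK n); rewrite leq_addr.
apply: ae_cvg_of_geometric_L2 => [n|n].
  exact/Kmeas/(K_0 (N n)).
(* The midpoint stays in [K (N n)], so its squared norm exceeds [inf S - e n], which forces [w n]
   and [w n.+1] to be close. *)
pose h x := 2^-1 * (w n x + w n.+1 x).
have wS_K : K (N n) (w n.+1) by apply: Kd (wK n.+1).
have hK : K (N n) h by exact: Kconv.
have hge : (inf S - e n < \int[mu]_(x in D) h x ^+ 2)%R.
  by apply: (svalP (inf_lb n)); exact: Kd (m_le n) _ hK.
have iw := Kint _ (K_0 _ _ (wK n)).
have iwS := Kint _ (K_0 _ _ wS_K).
have ih := Kint _ (K_0 _ _ hK).
have i2w := integrableZl mD 2 iw.
have i2wS := integrableZl mD 2 iwS.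
have i4h := integrableZl mD 4 ih.
have parallelogram x : (w n.+1 x - w n x) ^+ 2 =
    2 * w n x ^+ 2 + 2 * w n.+1 x ^+ 2 - 4 * h x ^+ 2.
  by rewrite /h !expr2; lra.
have isum := integrableD mD i2w i2wS.
have idiff := integrableB mD isum i4h.
rewrite (eq_integral (fun x => (2 * w n x ^+ 2 + 2 * w n.+1 x ^+ 2 - 4 * h x ^+ 2)%:E)); last first.
  by move=> x _; rewrite parallelogram.
rewrite -[leLHS]fineK; last exact: integrable_fin_num.
rewrite lee_fin -/(Rintegral mu D (fun x => 2 * w n x ^+ 2 + 2 * w n.+1 x ^+ 2 - 4 * h x ^+ 2)).
rewrite RintegralB// RintegralD// !RintegralZl//.
have e8 : e n = 8^-1 * 8 ^- n by rewrite /e exprS invfM.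
have eS : e n.+1 <= e n.
  by rewrite lef_pV2 ?posrE ?exprn_gt0// ler_eXn2l// ltr1n.
have := wle n; have := wle n.+1.
move: e8 eS hge; lra.
Qed.

Lemma ae_bounded_integrable (g : T -> R) (C : R) :
  (mu D < +oo)%E -> 0 <= C -> measurable_fun D g ->
  {ae mu, forall x, D x -> `|g x| <= C} ->
  mu.-integrable D (EFin \o g) /\
  (\int[mu]_(x in D) `|(g x)%:E| <= C%:E * mu D)%E.
Proof.
move=> muD C0 mg gC.
have gle : (\int[mu]_(x in D) `|(g x)%:E| <= C%:E * mu D)%E.
  rewrite -integral_cst//; apply: ae_ge0_le_integral => //.
  by apply/measurable_EFinP; exact: measurableT_comp.
split=> //; apply/integrableP; split; first exact/measurable_EFinP.
by apply: le_lt_trans gle _; rewrite lte_mul_pinfty.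
Qed.

(** The upper limit in the extended reals is measurable on all of [D] and agrees with the limit
    wherever the sequence converges. The values that [fine] assigns elsewhere only concern a null
    set. *)
Lemma measurable_fun_ae_limit (f : (T -> R)^nat) :
  (forall n, measurable_fun D (f n)) ->
  {ae mu, forall x, D x -> cvgn (f ^~ x)} ->
  exists2 g : T -> R, measurable_fun D g &
    {ae mu, forall x, D x -> f ^~ x @ \oo --> g x}.
Proof.
move=> mf fcvg; exists (fun x => fine (limn_esup (fun n => (f n x)%:E))).
  apply: (@measurableT_comp _ _ _ _ _ _ fine) => //.
  by apply: measurable_fun_limn_esup => n; exact/measurable_EFinP.
apply: filterS fcvg => x /[apply] fx.
have fxE : (fun n => (f n x)%:E) @ \oo --> (limn (f ^~ x))%:E.
  by apply: cvg_EFin => //; exact: nearW.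
rewrite is_cvg_limn_esupE; last by apply/cvg_ex; exists (limn (f ^~ x))%:E.
by rewrite (cvg_lim _ fxE).
Qed.

End measure.

Lemma bounded_onP (T : Type) (K : realFieldType) (V : normedModType K) (f : T -> V)
    (A : set T) :
  [bounded f x | x in A] <-> exists M, forall x, A x -> `|f x| <= M.
Proof.
split=> [[M [_ MP]]|[M MP]]; first by exists (M + 1); apply: MP; rewrite ltrDl.
by exists M; split=> [|y My x Ax]; [exact: num_real|exact: le_trans (MP _ Ax) (ltW My)].
Qed.

(** * Essential bounds and the variation on bounded open subsets of R^N *)

Section variation.
Context {R : realType} {N : nat}.
Implicit Types (D : set 'rV[R]_N) (u v g : 'rV[R]_N -> R).

Local Notation mu := (lebesgue_rV R N).

Lemma Lnorm_on_ooP D g (e : R) : 0 <= e ->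
  (Lnorm_on +oo D g <= e%:E)%E <-> {ae mu, forall x, D x -> `|g x| <= e}.
Proof.
move=> e0; rewrite /Lnorm_on unlock.
have aeE : {ae mu, forall x, (`|((EFin \o g) \_ D) x| <= e%:E)%E} <->
    {ae mu, forall x, D x -> `|g x| <= e}.
  split; apply: filterS => x; rewrite patchE; last first.
    by case: ifPn => [/set_mem Dx /(_ Dx)|_ _]; rewrite ?lee_fin//= normr0.
  by move=> + Dx; rewrite mem_set//= lee_fin.
case: ifPn => [mu0|]; first by rewrite -aeE; split=> /ess_supP.
(* In this branch the whole space has measure zero: the norm is 0 by definition, and every property
   holds almost everywhere. *)
rewrite lt0e measure_ge0 andbT negbK => /eqP mu0.
split=> _; [by exists setT|by rewrite lee_fin].
Qed.

Lemma open_measurable_rV D : open D -> measurable D.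
Proof. by move=> oD; apply: sub_sigma_algebra. Qed.

Lemma continuous_measurable_rV (f : 'rV[R]_N -> R) D :
  open D -> continuous f -> measurable_fun D f.
Proof.
move=> oD cf; apply: (measurability _ (RGenOpens.measurableE R)).
move=> _ [_ [a [b ->]] <-]; apply: measurableI; first exact: open_measurable_rV.
apply: open_measurable_rV; apply: open_comp; last exact: interval_open.
by move=> x _; exact: cf.
Qed.

(** A bound in the sup norm encloses [D] in a cube, whose measure is a finite product of finite
    lengths. *)
Lemma lebesgue_rV_bounded D : measurable D -> bounded_set D -> (mu D < +oo)%E.
Proof.
move=> mD /bounded_onP[M DM].
have mball : measurable [set x : 'rV[R]_N | forall i, `[- M, M]%classic (x 0 i)].
  rewrite [X in measurable X](_ : _ = \bigcap_(i in [set: 'I_N])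
      ((fun x : 'rV[R]_N => x 0 i) @^-1` `[- M, M]%classic)); last first.
    by apply/seteqP; split=> x /= Ax i; [move=> _|]; exact: Ax.
  apply: fin_bigcap_measurable => // i _; rewrite -[X in measurable X]setTI.
  exact: measurable_coord.
apply: (@le_lt_trans _ _ (mu [set x | forall i, `[- M, M]%classic (x 0 i)])).
  apply: le_measure; rewrite ?inE//.
  move=> x Dx i /=; rewrite in_itv/= -ler_norml.
  by apply: le_trans (DM _ Dx); rewrite /Num.norm/= mx_normrE; exact: (le_bigmax _ _ (0, i)).
rewrite (@lebesgue_rV_box R N (fun=> `[- M, M]%classic))//.
rewrite ltey_eq; apply/orP; left.
apply: (big_ind (fun x : \bar R => x \is a fin_num)) => [//|x y|i _].
  exact: fin_numM.
by rewrite lebesgue_measure_itv/=; case: ifPn.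
Qed.

Lemma divergence_continuous D (phi : 'rV[R]_N -> 'rV[R]_N) :
  C1c D phi -> continuous (divergence phi).
Proof.
move=> [_ dphi _ _].
apply: (@continuous_big R^o) => [|i _ x]; first exact: add_continuous.
apply: (@continuous_comp _ _ _ ('D_(unit_row i) phi) (fun y : 'rV[R]_N => y 0 i)).
  exact: dphi.
exact: coord_continuous.
Qed.

(** A bounded set may fail to be closed, so compactness is applied to a closed ball containing
    [D]. *)
Lemma continuous_bounded_on D (f : 'rV[R]_N -> R) :
  bounded_set D -> continuous f -> [bounded f x | x in D].
Proof.
move=> /bounded_onP[M DM] cf.
pose B : set 'rV[R]_N := [set x | `|x| <= M].
have cB : compact B.
  apply: bounded_closed_compact.
    by apply/bounded_onP; exists M.
  apply: (@closed_comp _ _ (fun x : 'rV[R]_N => `|x|) [set y | y <= M]).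
    by move=> x _; exact: norm_continuous.
  exact: closed_le.
have /compact_bounded/bounded_onP[C fC] : compact (f @` B).
  apply: continuous_compact => //; exact: continuous_subspaceT.
apply/bounded_onP; exists C => x Dx.
by apply: fC; exists x => //; exact: DM.
Qed.

Lemma integrable_mul_divergence D v (phi : 'rV[R]_N -> 'rV[R]_N) :
  open D -> bounded_set D -> C1c D phi -> L1 D v ->
  mu.-integrable D (fun x => (v x * divergence phi x)%:E).
Proof.
move=> oD bD Cphi L1v; have cdiv := divergence_continuous Cphi.
have := integrableMr (open_measurable_rV oD) (continuous_measurable_rV oD cdiv)
  (continuous_bounded_on bD cdiv) L1v.
by apply: eq_integrable; [exact: open_measurable_rV|move=> x _; rewrite /= mulrC].
Qed.

(** The zero field is an admissible test field. *)
Lemma Var_ge0 D u : (0 <= Var D u)%E.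
Proof.
apply: ereal_sup_ubound; exists (cst 0).
  split.
    have supp0 : closure [set x | (cst 0 : 'rV[R]_N -> 'rV[R]_N) x != 0] = set0.
      rewrite (_ : [set x | _] = set0) ?closure0//.
      by apply/seteqP; split=> x //=; rewrite eqxx.
    split; rewrite ?supp0 //; last exact: compact0.
    move=> h; rewrite (_ : 'D_h _ = cst 0); first exact: cst_continuous.
    by apply/funext => y; exact: derive_cst.
  apply/(Lnorm_on_ooP _ _ ler01); apply: aeW => x _.
  by rewrite /enorm big1 ?sqrtr0 ?normr0// => i _; rewrite mxE expr0n.
rewrite (eq_integral (cst 0%E)) ?integral0// => x _.
rewrite /divergence big1 ?mulr0// => i _.
by rewrite derive_cst mxE.
Qed.

(** For a fixed test field the integral is linear in the function, and a supremum of linear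
    functionals is convex. *)
Lemma Var_midpoint_le D u v (c : R) : open D -> bounded_set D ->
  L1 D u -> L1 D v -> (Var D u <= c%:E)%E -> (Var D v <= c%:E)%E ->
  (Var D (fun x => 2^-1 * (u x + v x))%R <= c%:E)%E.
Proof.
move=> oD bD L1u L1v uc vc; apply: ge_ereal_sup => _ [phi [Cphi phi1] <-].
have iu := integrable_mul_divergence oD bD Cphi L1u.
have iv := integrable_mul_divergence oD bD Cphi L1v.
have mD := open_measurable_rV oD.
have {}uc : (\int[mu]_(x in D) (u x * divergence phi x)%:E <= c%:E)%E.
  by apply: le_trans uc; apply: ereal_sup_ubound; exists phi.
have {}vc : (\int[mu]_(x in D) (v x * divergence phi x)%:E <= c%:E)%E.
  by apply: le_trans vc; apply: ereal_sup_ubound; exists phi.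
rewrite (eq_integral (fun x => (2^-1)%:E *
    ((u x * divergence phi x)%:E + (v x * divergence phi x)%:E))%E); last first.
  by move=> x _; rewrite -EFinD -EFinM -mulrA mulrDl.
rewrite integralZl//; last exact: integrableD.
rewrite integralD//.
rewrite (_ : c%:E = (2^-1)%:E * (c%:E + c%:E))%E.
  by rewrite lee_wpmul2l// ?lee_fin ?invr_ge0// leeD.
by rewrite -EFinD -EFinM; congr EFin; lra.
Qed.

(** Lower semicontinuity of the variation: for each fixed test field the integrals converge by
    dominated convergence, so the bounds [c_ n] pass to the limit before the supremum is taken. *)
Lemma Var_le_of_ae_cvg D (v_ : ('rV[R]_N -> R)^nat) v h (c_ : R^nat) (c : R) :
  open D -> bounded_set D ->
  (forall n, L1 D (v_ n)) -> measurable_fun D v -> L1 D h ->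
  {ae mu, forall x n, D x -> `|v_ n x| <= h x} ->
  {ae mu, forall x, D x -> v_ ^~ x @ \oo --> v x} ->
  (forall n, (Var D (v_ n) <= (c_ n)%:E)%E) -> c_ @ \oo --> c ->
  (Var D v <= c%:E)%E.
Proof.
move=> oD bD L1v mv L1h v_h v_v Varv cc.
apply: ge_ereal_sup => _ [phi [Cphi phi1] <-].
have mD := open_measurable_rV oD.
have cdiv := divergence_continuous Cphi.
have mdiv := continuous_measurable_rV oD cdiv.
have [C divC] := (bounded_onP _ _).1 (continuous_bounded_on bD cdiv).
(* The majorant is [C * h], where [C] bounds the divergence of [phi] on [D]. *)
have [|||||_ _ cvgI] := @dominated_convergence _ _ _ mu D mD
    (fun n x => (v_ n x * divergence phi x)%:E)
    (fun x => (v x * divergence phi x)%:E) (fun x => (C%:E * (h x)%:E)%E).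
- move=> n; apply/measurable_EFinP; apply: measurable_funM => //.
  by apply/measurable_EFinP; have /integrableP[] := L1v n.
- by apply/measurable_EFinP; exact: measurable_funM.
- apply: filterS v_v => x /[apply] vx; apply: cvg_EFin; first exact: nearW.
  by apply: cvgM => //; exact: cvg_cst.
- exact: integrableZl.
- apply: filterS v_h => x hx n Dx; rewrite -EFinM lee_fin normrM mulrC.
  by rewrite ler_pM//; [exact: divC|exact: hx].
have cc' : (fun n => (c_ n)%:E) @ \oo --> c%:E by apply: cvg_EFin => //; exact: nearW.
apply: (lee_cvg_to cvgI cc'); apply: nearW => n.
by apply: le_trans (Varv n); apply: ereal_sup_ubound; exists phi.
Qed.

End variation.

(** * Attainment of the infimum defining [epsVar] *)

Theorem proposition3p17 (R : realType) (N : nat) (Omega : set 'rV[R]_N)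
    (u : 'rV[R]_N -> R) (eps : R) :
  (0 < N)%N ->
  open Omega -> bounded_set Omega ->
  (N = 1%N -> forall i : 'I_N, is_interval [set x 0 i | x in Omega]) ->
  BV_extension_domain Omega ->
  Rinfty Omega u -> 0 < eps ->
  exists v : 'rV[R]_N -> R,
    [/\ BV Omega v,
        (Lnorm_on +oo Omega (u \- v)%R <= eps%:E)%E &
        Var Omega v = epsVar eps Omega u].
Proof.
move=> _ oO bO _ _ [L1u uVar] eps0.
have mO := open_measurable_rV oO.
have muO := lebesgue_rV_bounded mO bO.
have eps0' := ltW eps0.
pose mu := lebesgue_rV R N.
have I_fin : epsVar eps Omega u \is a fin_num.
  rewrite ge0_fin_numE ?uVar//; apply: le_ereal_inf_tmp => _ [v _ <-].
  exact: Var_ge0.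
pose i := fine (epsVar eps Omega u).
have iE : epsVar eps Omega u = i%:E by rewrite fineK.
have bounded_L1 (w : 'rV[R]_N -> R) : measurable_fun Omega w ->
    {ae mu, forall x, Omega x -> `|w x| <= eps} -> L1 Omega w.
  by move=> mw weps; have [] := ae_bounded_integrable mO muO eps0' mw weps.
have L1B (w : 'rV[R]_N -> R) : L1 Omega w -> L1 Omega (u \- w).
  by move=> L1w; exact: (integrableB mO L1u L1w).
(* The sets contain the differences [w] between [u] and its approximants: [u] is only known to be
   integrable, whereas [|w| <= eps] on a set of finite measure makes [w] square integrable. *)
pose K n := [set w : 'rV[R]_N -> R | [/\ measurable_fun Omega w,
  {ae mu, forall x, Omega x -> `|w x| <= eps} &
  (Var Omega (u \- w)%R <= (i + n.+1%:R^-1)%:E)%E]].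
have sqr_bound (w : 'rV[R]_N -> R) : measurable_fun Omega w ->
    {ae mu, forall x, Omega x -> `|w x| <= eps} ->
    mu.-integrable Omega (EFin \o (fun x => w x ^+ 2)) /\
    (\int[mu]_(x in Omega) `|(w x ^+ 2)%:E| <= (eps ^+ 2)%:E * mu Omega)%E.
  move=> mw weps; apply: ae_bounded_integrable => //.
  - exact: sqr_ge0.
  - exact: measurable_funX.
  - apply: filterS weps => x /[apply] wx.
    by rewrite normrX ler_sqr ?nnegrE.
have [w [wK wcvg]] : exists w : ('rV[R]_N -> R)^nat, (forall n, K n (w n)) /\
    {ae mu, forall x, Omega x -> cvgn (w ^~ x)}.
  apply: (@ae_cvg_convex_seq _ _ _ mu Omega mO K (fine ((eps ^+ 2)%:E * mu Omega)%E)).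
  - move=> m n mn w [mw weps wVar]; split=> //; apply: le_trans wVar _.
    by rewrite lee_fin lerD2l lef_pV2 ?posrE// ler_nat.
  - move=> n.
    have n0 : 0 < n.+1%:R^-1 :> R by rewrite invr_gt0.
    (* An approximant [v] whose variation is within [n.+1%:R^-1] of the infimum gives the element
       [u \- v] of [K n]. *)
    have [_ [v [[L1v _] uv] <-]] := lb_ereal_inf_adherent n0 I_fin.
    rewrite -/(epsVar eps Omega u) iE -EFinD => /ltW vi.
    exists (u \- v); split.
    + by apply/measurable_EFinP; have /integrableP[] := L1B _ L1v.
    + by apply/Lnorm_on_ooP.
    + by rewrite (_ : u \- (u \- v) = v)//; apply/funext => x /=; rewrite opprB addrC subrK.
  - move=> n f g [mf feps fVar] [mg geps gVar]; split.
    + by apply: measurable_funM => //; exact: measurable_funD.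
    + apply: filterS2 feps geps => x + + Ox => /(_ Ox) fx /(_ Ox) gx.
      rewrite normrM ger0_norm ?invr_ge0//.
      by have := ler_normD (f x) (g x); lra.
    + rewrite (_ : u \- _ = (fun x => 2^-1 * ((u \- f) x + (u \- g) x))); last first.
        by apply/funext => x /=; lra.
      by apply: Var_midpoint_le => //; apply/L1B/bounded_L1.
  - by move=> f [].
  - by move=> f [mf feps _]; exact: (sqr_bound _ mf feps).1.
  - move=> f [mf feps _]; have [fint fle] := sqr_bound _ mf feps.
    have bfin : ((eps ^+ 2)%:E * mu Omega)%E \is a fin_num.
      by rewrite fin_numM// ge0_fin_numE.
    apply: fine_le => //; first exact: integrable_fin_num.
    apply: le_trans fle; rewrite le_eqVlt; apply/orP; left; apply/eqP.
    by apply: eq_integral => x _; rewrite gee0_abs// lee_fin sqr_ge0.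
have mw n : measurable_fun Omega (w n) by case: (wK n).
have [W mW wW] := measurable_fun_ae_limit mw wcvg.
have weps : {ae mu, forall x n, Omega x -> `|w n x| <= eps}.
  by apply/ae_foralln => n; case: (wK n).
have Weps : {ae mu, forall x, Omega x -> `|W x| <= eps}.
  apply: filterS2 weps wW => x + + Ox => wx /(_ Ox) cvgx.
  apply: (@cvgr_to_le _ _ _ _ _ _ _ (cvg_norm cvgx)).
  by apply: nearW => n; exact: wx.
have L1W := bounded_L1 _ mW Weps.
have VarW : (Var Omega (u \- W)%R <= i%:E)%E.
  (* The slack [n.+1%:R^-1] vanishes in the limit, and [|u| + eps] dominates all the functions
     [u \- w n]. *)
  apply: (@Var_le_of_ae_cvg _ _ _ (fun n => u \- w n) _ (fun x => `|u x| + eps)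
    (fun n => i + n.+1%:R^-1)) => //.
  - by move=> n; apply/L1B/bounded_L1; case: (wK n).
  - by apply/measurable_EFinP; have /integrableP[] := L1B _ L1W.
  - have ceps : mu.-integrable Omega (EFin \o cst eps).
      apply: (ae_bounded_integrable mO muO eps0' _ _).1 => //.
      by apply: aeW => x _; rewrite ger0_norm.
    exact: (integrableD mO (integrable_norm L1u) ceps).
  - apply: filterS weps => x wx n Ox.
    by apply: le_trans (ler_normB _ _) _; rewrite lerD2l wx.
  - apply: filterS wW => x /[apply] cvgx.
    by apply: cvgB => //; exact: cvg_cst.
  - by move=> n; case: (wK n).
  - rewrite -[X in _ --> X]addr0; apply: cvgD; first exact: cvg_cst.
    exact: cvg_harmonic.
have BVv : BV Omega (u \- W).
  by split; [exact: L1B|apply: le_lt_trans VarW _; rewrite ltry].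
have uv : (Lnorm_on +oo Omega (u \- (u \- W))%R <= eps%:E)%E.
  apply/Lnorm_on_ooP => //; apply: filterS Weps => x /[apply].
  by rewrite /= opprB addrC subrK.
(* One inequality is [VarW]; the other holds because [u \- W] is itself a competitor in the
   infimum. *)
exists (u \- W); split => //; apply/eqP; rewrite eq_le iE VarW -iE andTb.
by apply: ereal_inf_lbound; exists (u \- W).
Qed.
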